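(* Let $\mathfrak G=\{G_i\}_{i\in I}$ be a family of finite groups. Then the mapping $\mathcal X\mapsto\mathcal T(\mathcal X)$ gives a one-to-one correspondence between the quasiregular coherent configurations of type $\mathfrak G$ and the systems of linked quotients based on $\mathfrak G$.
   Context: A coherent configuration is a pair $(\Omega,S)$ where $\Omega$ is a finite set and $S$ is a partition of $\Omega\times\Omega$ (basis relations) such that $1_\Omega$ is a union of basis relations, $s^*=\{(\beta,\alpha):(\alpha,\beta)\in s\}\in S$ for all $s\in S$, and for all $r,s,t\in S$ the number $|\alpha r\cap\beta s^*|$ is independent of $(\alpha,\beta)\in t$, where $\alpha r=\{\beta:(\alpha,\beta)\in r\}$. A fiber is a set $\Delta$ with $1_\Delta\in S$. A relation $s$ is thin if $|\alpha s|\le1$ and $|\alpha s^*|\le1$ for all $\alpha$. The configuration is quasiregular if for each fiber all basis relations contained in its square are thin; it is of type $\mathfrak G$ if its fibers are $\Omega_i$, $i\in I$, and the group (under composition of relations) of basis relations contained in $\Omega_i\times\Omega_i$ is $G_i$. The complex product $rs$ of basis relations is the set of basis relations contained in $\{(\alpha,\beta):(\alpha,\gamma)\in r,(\gamma,\beta)\in s\text{ for some }\gamma\}$, extended to sets by $XY=\bigcup_{r\in X,s\in Y}rs$. For such $\mathcal X$, $\mathcal T(\mathcal X)=(\{G_i\},\{G_i/G_{ij}\},\{f_{ij}\})$ where, after choosing $\alpha_i\in\Omega_i$ and letting $s_{ij}$ be the basis relation containing $(\alpha_i,\alpha_j)$, $G_{ij}=s_{ij}s_{ij}^*\trianglelefteq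 G_i$ and $f_{ij}:G_i/G_{ij}\to G_j/G_{ji}$, $G_{ij}s\mapsto s_{ij}^*(G_{ij}s)s_{ij}$. A system of linked quotients based on $\{G_i\}_{i\in I}$ consists of normal subgroups $G_{ij}\trianglelefteq G_i$ with $G_{ii}=1$ and isomorphisms $f_{ij}:G_i/G_{ij}\to G_j/G_{ji}$ with $f_{ii}=\mathrm{id}$, $f_{ij}f_{ji}=\mathrm{id}$, such that for all $i,j,k$: $f_{ik}$ maps $G_{ij}G_{ik}/G_{ik}$ onto $G_{ki}G_{kj}/G_{ki}$ (inducing $f_{ijk}:G_i/G_{ij}G_{ik}\to G_k/G_{ki}G_{kj}$), and the composite of $f_{ijk}$, then $f_{kij}$, then $f_{jki}$ is the identity of $G_i/G_{ij}G_{ik}$. *)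

(* Defs.v *)
From HB Require Import structures.
From mathcomp Require Import all_boot all_fingroup.

Set Implicit Arguments.
Unset Strict Implicit.
Unset Printing Implicit Defensive.

Local Open Scope group_scope.

Section Relations.

Variable Om : finType.
Implicit Types (r s t : {set Om * Om}) (D : {set Om}).
Implicit Types (S X Y : {set {set Om * Om}}).

Definition diag D : {set Om * Om} := [set (a, a) | a in D].

Definition converse s : {set Om * Om} := [set (p.2, p.1) | p in s].

Definition neighbours (a : Om) r : {set Om} := [set b | (a, b) \in r].

Definition compose r s : {set Om * Om} :=
  [set p | [exists c, ((p.1, c) \in r) && ((c, p.2) \in s)]].

Definition coherent S : Prop :=
  [/\ partition S [set: Om * Om],
      exists2 X : {set {set Om * Om}}, X \subset S & diag [set: Om] = cover X,
      forall s, s \in S -> converse s \in S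
    & forall r s t, r \in S -> s \in S -> t \in S ->
      forall p q, p \in t -> q \in t ->
        #|neighbours p.1 r :&: neighbours p.2 (converse s)|
        = #|neighbours q.1 r :&: neighbours q.2 (converse s)| ].

Definition fiber S D : bool := diag D \in S.

Definition thin s : Prop :=
  forall a, (#|neighbours a s| <= 1)%N /\ (#|neighbours a (converse s)| <= 1)%N.

Definition inside S D : {set {set Om * Om}} := [set s in S | s \subset setX D D].

Definition quasiregular S : Prop :=
  forall D, fiber S D -> forall s, s \in inside S D -> thin s.

Definition complex_product S X Y : {set {set Om * Om}} :=
  \bigcup_(r in X) \bigcup_(s in Y) [set t in S | t \subset compose r s].

End Relations.

Section Type_G.

Variables (I : finType) (gT : I -> finGroupType).

(* The G_i are abstract groups, so that being of type {G_i} is the datum of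
   the indexing of the fibers by I together with isomorphisms (qc_rel i) from
   G_i onto the group of basis relations inside the i-th fiber. *)
Record qr_config := QrConfig {
  qc_point :> finType;
  qc_basis : {set {set qc_point * qc_point}};
  qc_fiber : I -> {set qc_point};
  qc_rel : forall i, gT i -> {set qc_point * qc_point};
  qc_coherent : coherent qc_basis;
  qc_quasiregular : quasiregular qc_basis;
  qc_fiber_inj : injective qc_fiber;
  qc_fiberP : forall D, fiber qc_basis D <-> exists i, D = qc_fiber i;
  qc_rel_inj : forall i, injective (@qc_rel i);
  qc_rel_im : forall i,
    [set qc_rel x | x in [set: gT i]] = inside qc_basis (qc_fiber i);
  qc_relM : forall i (x y : gT i),
    qc_rel (x * y) = compose (qc_rel x) (qc_rel y) }.

(* A quotient G_i / G_ij is handled as the set of cosets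
   rcosets (G_ij) [set: gT i] with the setwise product, so the isomorphism
   f_ij is a map on subsets of which only the values on cosets matter;
   this is accounted for by [same_system]. *)
Record quotient_data := QuotientData {
  qd_sub : forall i : I, I -> {set gT i};
  qd_map : forall i j : I, {set gT i} -> {set gT j} }.

Arguments qd_map : clear implicits.

Definition same_system (F F' : quotient_data) : Prop :=
  (forall i j, qd_sub F i j = qd_sub F' i j)
  /\ (forall i j (C : {set gT i}), C \in rcosets (qd_sub F i j) [set: gT i] ->
        qd_map F i j C = qd_map F' i j C).

Definition coset_isom (aT rT : finGroupType) (H : {set aT}) (K : {set rT})
    (f : {set aT} -> {set rT}) : Prop :=
  [/\ {in rcosets H [set: aT] &, {morph f : C D / C * D}},
      {in rcosets H [set: aT] &, injective f}
    & f @: rcosets H [set: aT] = rcosets K [set: rT]].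

(* f_ijk : G_i / G_ij G_ik -> G_k / G_ki G_kj, induced by f_ik: a coset of
   G_ij G_ik is a union of cosets of G_ik, to each of which f_ik applies. *)
Definition induced_map (F : quotient_data) (i j k : I) (C : {set gT i}) :
    {set gT k} :=
  \bigcup_(D in rcosets (qd_sub F i k) C) qd_map F i k D.

Definition linked (F : quotient_data) : Prop :=
  let N := qd_sub F in let f := qd_map F in let f3 := induced_map F in
  [/\ forall i j, group_set (N i j) /\ N i j <| [set: gT i],
      forall i, N i i = 1,
      forall i j, coset_isom (N i j) (N j i) (f i j),
      (forall i (C : {set gT i}), C \in rcosets (N i i) [set: gT i] -> f i i C = C)
      /\ (forall i j (C : {set gT i}), C \in rcosets (N i j) [set: gT i] -> f j i (f i j C) = C)
    & forall i j k,
        f i k @: rcosets (N i k) (N i j * N i k)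
        = rcosets (N k i) (N k i * N k j)
        /\ (forall C : {set gT i}, C \in rcosets (N i j * N i k) [set: gT i] ->
              f3 j k i (f3 k i j (f3 i j k C)) = C)].

Definition base_points (X : qr_config) (a : I -> X) : Prop :=
  forall i, a i \in qc_fiber X i.

Definition base_rel (X : qr_config) (a : I -> X) (i j : I) : {set X * X} :=
  pblock (qc_basis X) (a i, a j).

Definition system_of (X : qr_config) (a : I -> X) : quotient_data :=
  let S := qc_basis X in let s := base_rel a in
  {| qd_sub := fun i j =>
       [set x | qc_rel X x
                \in complex_product S [set s i j] [set converse (s i j)]];
     qd_map := fun i j C =>
       [set y | qc_rel X y
                \in complex_product S
                      (complex_product S [set converse (s i j)]
                                         [set qc_rel X x | x in C])
                      [set s i j]] |}.

(* system_of depends on the base points: moving them changes f_ij by inner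
   automorphisms of G_i and G_j.  Hence configurations with chosen base points
   are compared, by isomorphisms respecting these and the type structure.
   Such an isomorphism is determined by the base points; in particular it is
   the identity between two configurations that differ only in qc_basis. *)
Definition based_iso (X : qr_config) (a : I -> X) (Y : qr_config) (b : I -> Y) :
    Prop :=
  exists phi : X -> Y,
    let phi2 (s : {set X * X}) := [set (phi p.1, phi p.2) | p in s] in
    [/\ bijective phi,
        qc_basis Y = [set phi2 s | s in qc_basis X],
        forall i, qc_fiber Y i = phi @: qc_fiber X i,
        forall i (x : gT i), qc_rel Y x = phi2 (qc_rel X x)
      & forall i, phi (a i) = b i].

End Type_G.

(* Main.v *)
(* A system of linked quotients is the same thing as a family of subgroups
   R_ij of G_i * G_j, namely R_ij = {(x, y) : y in f_ij(G_ij x)}, with R_ii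
   the identity, R_ji the transpose of R_ij, full projections, and R_ij
   contained in the composition of R_ik and R_kj for all i, j, k. The two
   conditions on triples of a system of linked quotients amount to this last
   inclusion.

   Given a configuration with base points a_i, every point of the i-th fiber
   is a_i x for a unique x in G_i, and R_ij is the set of the (x, y) such
   that (a_i x, a_j y) lies in s_ij; the inclusion holds because the
   composition of s_ik and s_kj is a union of basis relations and contains
   (a_i, a_j). The relations R_ij determine the configuration, because the
   basis relations between the fibers i and j are the s_ij y with y in G_j.
   Conversely, given the R_ij, the orbits of the R_ij acting on G_i * G_j by
   left translations are the basis relations of a coherent configuration:
   for (g, h) in R_ik, pick w with (g, w) in R_ij and (w, h) in R_jk; then
   translation by w maps the points between (x, z) onto those between (g x,
   h z), preserving the types of the edges. *)
Require Import Defs.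
From mathcomp Require Import all_boot all_fingroup.

Set Implicit Arguments.
Unset Strict Implicit.
Unset Printing Implicit Defensive.

Arguments qd_map {I gT} q i j C.
Arguments induced_map {I gT} F i j k C.

(** * Linkages and the quotient data they represent *)

Section Linkages.

Local Open Scope group_scope.

Variables (I : finType) (gT : I -> finGroupType).

Definition fiber_rel := forall i j, gT i -> gT j -> bool.

Implicit Types (R : fiber_rel) (F : quotient_data gT).

Definition mul_closed R :=
  forall i j x y x' y',
    R i j x y -> R i j x' y' -> R i j (x * x') (y * y').

Record linkage R : Prop := Linkage {
  linkage_id : forall i x y, R i i x y = (x == y);
  linkage_sym : forall i j x y, R i j x y = R j i y x;
  linkage_total : forall i j x, exists y, R i j x y;
  linkage_mul : mul_closed R;
  linkage_comp : forall i j k x y,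
    R i j x y -> exists2 z, R i k x z & R k j z y }.

(** [qd_map] is prescribed on cosets only, which is all that [same_system] compares. *)
Definition represents R F :=
  (forall i j, qd_sub F i j = [set x | R i j x 1])
  /\ (forall i j x, qd_map F i j (qd_sub F i j :* x) = [set y | R i j x y]).

(** In a finite group inverses are positive powers, and a common multiple of the two orders gives
    one exponent that serves both coordinates. *)
Lemma mul_closedV R i j x y : mul_closed R -> R i j x y -> R i j x^-1 y^-1.
Proof.
move=> RM Rxy.
have Rexp n : R i j (x ^+ n.+1) (y ^+ n.+1).
  by elim: n => [|n IHn]; rewrite ?expg1 // !(expgS _ n.+1); apply: RM.
have [n nE] : exists n, n.+2 = (#[x] * #[y] * 2)%N.
  have : (1 < #[x] * #[y] * 2)%N.
    by rewrite leq_pmull // muln_gt0 !order_gt0.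
  by case: (_ * 2)%N => [|[|n]] // _; exists n.
have expV (T : finGroupType) (g : T) : #[g] %| n.+2 -> g^-1 = g ^+ n.+1.
  case/dvdnP=> m mE; apply: (mulgI g).
  by rewrite mulgV -expgS mE mulnC expgM expg_order expg1n.
have [dvd_x dvd_y] : #[x] %| n.+2 /\ #[y] %| n.+2.
  by rewrite nE; split; [rewrite -mulnA dvdn_mulr | rewrite mulnAC dvdn_mull].
by rewrite !expV.
Qed.

Lemma linkage1 R i j : linkage R -> R i j 1 1.
Proof.
move=> LR; have [y R1y] := linkage_total LR j (1 : gT i).
have RM := linkage_mul LR.
by have := RM _ _ _ _ _ _ R1y (mul_closedV RM R1y); rewrite !mulgV.
Qed.

Lemma represents_same R R' F F' :
    (forall i j x y, R i j x y = R' i j x y) ->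
  represents R F -> represents R' F' -> same_system F F'.
Proof.
move=> eqR [NE fE] [NE' fE'].
have eqN i j : qd_sub F i j = qd_sub F' i j.
  by rewrite NE NE'; apply/setP=> x; rewrite !inE eqR.
split=> // i j C /rcosetsP[x _ ->]; rewrite fE eqN fE'.
by apply/setP=> y; rewrite !inE eqR.
Qed.

Lemma same_represents R R' F F' :
    represents R F -> represents R' F' -> same_system F F' ->
  forall i j x y, R i j x y = R' i j x y.
Proof.
move=> [NE fE] [NE' fE'] [eqN eqf] i j x y.
have xN : qd_sub F i j :* x \in rcosets (qd_sub F i j) [set: gT i].
  by apply/rcosetsP; exists x.
by have := eqf i j _ xN; rewrite fE eqN fE' => /setP/(_ y); rewrite !inE.
Qed.

(** * From linkages to systems of linked quotients *)

Section LinkedOfLinkage.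

Variables (R : fiber_rel) (F : quotient_data gT).
Arguments R : clear implicits.
Hypotheses (LR : linkage R) (RF : represents R F).

Let RM := linkage_mul LR.
Let RC := linkage_comp LR.
Let R1 i j : R i j 1 1 := linkage1 i j LR.
Let RV i j x y : R i j x y -> R i j x^-1 y^-1 := @mul_closedV _ i j x y RM.

Let Rdiv i j x y x' y' :
  R i j x y -> R i j x' y' -> R i j (x * x'^-1) (y * y'^-1).
Proof. by move=> Rxy /RV; apply: RM. Qed.

Fact kernel_group_set i j : group_set [set x | R i j x 1].
Proof.
apply/group_setP; split=> [|x y]; first by rewrite inE.
by rewrite !inE => Rx Ry; rewrite -(mulg1 1); apply: RM.
Qed.

Canonical kernel i j := Group (kernel_group_set i j).

Lemma qd_sub_kernel i j : qd_sub F i j = kernel i j.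
Proof. exact: RF.1. Qed.

Lemma mem_kernel i j x : (x \in kernel i j) = R i j x 1.
Proof. by rewrite inE. Qed.

(** Any g has a partner h, and conjugating the pair (x, 1) by (g, h) keeps the second coordinate
    equal to 1. *)
Lemma kernel_normal i j : kernel i j <| [set: gT i].
Proof.
rewrite /normal subsetT; apply/subsetP=> g _; rewrite inE.
apply/subsetP=> _ /imsetP[x + ->]; rewrite !mem_kernel => Rx.
have [h Rgh] := linkage_total LR j g.
by have := RM (RM (RV Rgh) Rx) Rgh; rewrite mulg1 mulVg conjgE mulgA.
Qed.

Lemma linkage_rcoset i j x y :
  R i j x y -> [set z | R i j x z] = kernel j i :* y.
Proof.
move=> Rxy; apply/setP=> z; rewrite mem_rcoset mem_kernel inE.
rewrite [R j _ _ _](linkage_sym LR).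
apply/idP/idP=> [Rxz|Rzy]; first by rewrite -(mulgV x) Rdiv.
by rewrite -(mul1g x) -(mulgKV y z) RM.
Qed.

Lemma qd_map_rcoset i j x y :
  R i j x y -> qd_map F i j (kernel i j :* x) = kernel j i :* y.
Proof. by move=> Rxy; rewrite -qd_sub_kernel RF.2 (linkage_rcoset Rxy). Qed.

Lemma mem_qd_map i j x y : (y \in qd_map F i j (kernel i j :* x)) = R i j x y.
Proof. by rewrite -qd_sub_kernel RF.2 inE. Qed.

(** Composites of induced maps thus become paths of related elements, for arbitrary sets C and
    without handling cosets. *)
Lemma mem_induced_map i j k (C : {set gT i}) z :
  reflect (exists2 x, x \in C & R i k x z) (z \in induced_map F i j k C).
Proof.
apply: (iffP bigcupP) => [[_ /rcosetsP[x xC ->]]|[x xC Rxz]].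
  by rewrite qd_sub_kernel mem_qd_map; exists x.
exists (kernel i k :* x); last by rewrite mem_qd_map.
by rewrite qd_sub_kernel; apply/rcosetsP; exists x.
Qed.

Lemma linked_of_linkage : linked F.
Proof.
have Nnorm i j x : x \in 'N(kernel i j).
  by have /andP[_ /subsetP] := kernel_normal i j; apply.
split.
- by move=> i j; rewrite qd_sub_kernel groupP kernel_normal.
- move=> i; rewrite qd_sub_kernel; apply/setP=> x.
  by rewrite mem_kernel (linkage_id LR) inE.
- move=> i j; rewrite !qd_sub_kernel; split.
  + move=> _ _ /rcosetsP[x _ ->] /rcosetsP[y _ ->].
    have [[x' Rx] [y' Ry]] := (linkage_total LR j x, linkage_total LR j y).
    rewrite rcoset_mul ?Nnorm // (qd_map_rcoset (RM Rx Ry)).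
    by rewrite (qd_map_rcoset Rx) (qd_map_rcoset Ry) rcoset_mul ?Nnorm.
  + move=> _ _ /rcosetsP[x _ ->] /rcosetsP[y _ ->] /setP eq_f.
    have [x' Rx] := linkage_total LR j x.
    have := eq_f x'; rewrite !mem_qd_map Rx => /esym Ry.
    by apply/rcoset_eqP; rewrite mem_rcoset mem_kernel -(mulgV x') Rdiv.
  + apply/setP=> D; apply/imsetP/rcosetsP=> [[_ /rcosetsP[x _ ->] ->]|[y _ ->]].
      have [y Rxy] := linkage_total LR j x.
      by exists y; rewrite ?inE // (qd_map_rcoset Rxy).
    have [x Ryx] := linkage_total LR i y.
    exists (kernel i j :* x); first by apply/rcosetsP; exists x.
    by rewrite (@qd_map_rcoset _ _ x y) // (linkage_sym LR).
- split=> [i C|i j C]; rewrite qd_sub_kernel => /rcosetsP[x _ ->].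
    by rewrite (@qd_map_rcoset _ _ x x) // (linkage_id LR).
  have [y Rxy] := linkage_total LR j x.
  by rewrite (qd_map_rcoset Rxy) (@qd_map_rcoset _ _ y x) // (linkage_sym LR).
move=> i j k; split.
  rewrite !qd_sub_kernel; apply/setP=> D; apply/imsetP/rcosetsP.
    case=> _ /rcosetsP[_ /mulsgP[u v uN vN ->] ->] ->.
    rewrite !mem_kernel in uN vN.
    (* The partner of u obtained by passing through k lies in [kernel k j]; v is in [kernel i k] and
       does not affect the image. *)
    have [w Ruw Rw1] := RC k uN.
    exists w; last first.
      by apply: qd_map_rcoset; rewrite -(mulg1 w) RM.
    by rewrite -(mul1g w) mem_mulg ?group1 ?mem_kernel.
  case=> _ /mulsgP[n w nN + ->] ->; rewrite mem_kernel => Rw1.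
  have [u Rwu Ru1] := RC i Rw1.
  exists (kernel i k :* u).
    apply/rcosetsP; exists u => //.
    by rewrite -(mulg1 u) mem_mulg ?group1 ?mem_kernel.
  rewrite (@qd_map_rcoset _ _ u w) 1?(linkage_sym LR) //.
  by rewrite rcosetM (rcoset_id nN).
rewrite !qd_sub_kernel.
have gH : group_set (kernel i j * kernel i k).
  apply/comm_group_setP/normC.
  by apply: subset_trans (subsetT _) _; case/andP: (kernel_normal i k).
move=> _ /rcosetsP[x0 _ ->]; set C := _ :* x0.
apply/setP=> x'; apply/mem_induced_map/idP.
  case=> y /mem_induced_map[z /mem_induced_map[x xC Rxz] Rzy].
  rewrite (linkage_sym LR) => Rx'y.
  (* Now z and z' are both related to y, so [z * z'^-1] is related to 1. Factoring this through i
     yields u in [kernel i j], and [x * x'^-1] differs from u by an element of [kernel i k]. *)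
  have [z' Rx'z' Rz'y] := RC k Rx'y.
  have Rzz' : R k j (z * z'^-1) 1 by rewrite -(mulgV y) Rdiv.
  have [u Rzu Ru1] := RC i Rzz'.
  rewrite (linkage_sym LR) in Rzu.
  have Rv : R i k (x * x'^-1 * u^-1) 1.
    by rewrite -(mulgV (z * z'^-1)); do 2?apply: Rdiv.
  have xx'H : x' * x^-1 \in Group gH.
    rewrite -groupV invMg invgK -(mulgKV u (x * _)) groupM //.
      by rewrite -[X in X \in _]mul1g mem_mulg ?group1 ?mem_kernel.
    by rewrite -[X in X \in _]mulg1 mem_mulg ?group1 ?mem_kernel.
  move: xC; rewrite !mem_rcoset => xH.
  by rewrite -(mulgKV x x') -mulgA (@groupM _ (Group gH)).
(* Conversely, factoring an edge from x' to y through k gives a closed path x', z, y, x'. *)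
move=> x'C; have [y Rxy] := linkage_total LR j x'.
have [z Rxz Rzy] := RC k Rxy.
exists y; last by rewrite (linkage_sym LR).
by apply/mem_induced_map; exists z => //; apply/mem_induced_map; exists x'.
Qed.

End LinkedOfLinkage.

(** * From systems of linked quotients to linkages *)

Definition system_rel F : fiber_rel :=
  fun i j x y => y \in qd_map F i j (qd_sub F i j :* x).

Section LinkageOfLinked.

Variable F : quotient_data gT.
Hypothesis LF : linked F.

Let R := system_rel F.
Arguments R : clear implicits.

Fact linked_group_set i j : group_set (qd_sub F i j).
Proof. by case: LF => /(_ i j)[]. Qed.

Canonical linked_group i j := Group (linked_group_set i j).

Let Nnorm i j x : x \in 'N(qd_sub F i j).
Proof. by case: LF => /(_ i j)[_ /andP[_ /subsetP]] + _ _ _ _; apply. Qed.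

Let mem_cosets i j x : qd_sub F i j :* x \in rcosets (qd_sub F i j) [set: gT i].
Proof. by apply/rcosetsP; exists x. Qed.

Lemma system_relP i j x y :
  reflect (qd_map F i j (qd_sub F i j :* x) = qd_sub F j i :* y)
          (system_rel F x y).
Proof.
apply: (iffP idP) => [|eq_f]; last by rewrite /system_rel eq_f rcoset_refl.
case: LF => _ _ /(_ i j)[_ _ im_f] _ _; rewrite /system_rel.
have : qd_map F i j (qd_sub F i j :* x) \in rcosets (qd_sub F j i) [set: gT j].
  by rewrite -im_f imset_f ?mem_cosets.
by case/rcosetsP=> z _ -> /rcoset_eqP.
Qed.

Let Rsym i j x y : R i j x y = R j i y x.
Proof.
have [_ _ _ [_ fK] _] := LF.
have f_sym i' j' u v : R i' j' u v -> R j' i' v u.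
  move/system_relP=> eq_f; apply/system_relP.
  by rewrite -eq_f fK ?mem_cosets.
by apply/idP/idP; apply: f_sym.
Qed.

Let Rtotal i j x : exists y, R i j x y.
Proof.
have [_ _ /(_ i j)[_ _ im_f] _ _] := LF.
have := mem_cosets j x => /(imset_f (qd_map F i j)).
by rewrite im_f => /rcosetsP[y _ eq_f]; exists y; apply/system_relP.
Qed.

Let RM : mul_closed R.
Proof.
move=> i j x y x' y' /system_relP eq_f /system_relP eq_f'; apply/system_relP.
have [_ _ /(_ i j)[fM _ _] _ _] := LF.
rewrite -(@rcoset_mul _ _ x x') ?Nnorm // fM ?mem_cosets //.
by rewrite eq_f eq_f' rcoset_mul ?Nnorm.
Qed.

Let RV i j x y : R i j x y -> R i j x^-1 y^-1 := @mul_closedV _ i j x y RM.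

Let Rdiv i j x y x' y' :
  R i j x y -> R i j x' y' -> R i j (x * x'^-1) (y * y'^-1).
Proof. by move=> Rxy /RV; apply: RM. Qed.

Let R1 i j : R i j 1 1.
Proof.
have [y R1y] := Rtotal j (1 : gT i).
by have := Rdiv R1y R1y; rewrite !mulgV.
Qed.

(** One direction holds because f_ij sends the trivial coset to the trivial coset, the other because
    f_ij is injective on cosets. *)
Lemma mem_linked_group i j (x : gT i) : (x \in qd_sub F i j) = R i j x 1.
Proof.
have f1 : qd_map F i j (qd_sub F i j) = qd_sub F j i.
  by have /system_relP := R1 i j; rewrite !mulg1.
have [_ _ /(_ i j)[_ f_inj _] _ _] := LF.
apply/idP/system_relP => [xN|]; first by rewrite rcoset_id // mulg1.
have := mem_cosets j (1 : gT i); rewrite !mulg1 -[X in _ = X -> _]f1 => N1 eq_f.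
by rewrite -(f_inj _ _ (mem_cosets j x) N1 eq_f) rcoset_refl.
Qed.

Lemma mem_linked_induced i j k (C : {set gT i}) z :
  reflect (exists2 x, x \in C & R i k x z) (z \in induced_map F i j k C).
Proof.
apply: (iffP bigcupP) => [[_ /rcosetsP[x xC ->]]|[x xC Rxz]]; first by exists x.
by exists (qd_sub F i k :* x); first by apply/rcosetsP; exists x.
Qed.

(** Elementwise form of the first condition on triples, applied to f_ij. *)
Let Rker i j k x y :
  x \in qd_sub F i k -> R i j x y -> y \in qd_sub F j i * qd_sub F j k.
Proof.
move=> xN /system_relP eq_f; have [_ _ _ _ /(_ i k j)[/setP im_f _]] := LF.
have : qd_sub F j i :* y \in rcosets (qd_sub F j i) (qd_sub F j i * qd_sub F j k).
  rewrite -im_f -eq_f imset_f //; apply/rcosetsP; exists x => //.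
  by rewrite -[x]mulg1 mem_mulg ?group1.
case/rcosetsP=> _ /mulsgP[u v uN vN ->]; rewrite rcosetM (rcoset_id uN) => eqN.
have : y \in qd_sub F j i :* v by rewrite -eqN rcoset_refl.
by case/rcosetP=> n nN ->; rewrite mem_mulg.
Qed.

(** Walk from x around the triangle through k and j back to i. The second condition on triples
    bounds the discrepancy at the return point; [Rker] transports it to j and then to k, where it is
    absorbed by changing z. *)
Let Rcomp i j k x y : R i j x y -> exists2 z, R i k x z & R k j z y.
Proof.
move=> Rxy; have [_ _ _ _ /(_ i j k)[_ fK]] := LF.
have [z Rxz] := Rtotal k x; have [y' Rzy'] := Rtotal j z.
have [x' Ry'x'] := Rtotal i y'.
have : x' \in (qd_sub F i j * qd_sub F i k) :* x.
  rewrite -(fK (_ :* x)); last by apply/rcosetsP; exists x.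
  apply/mem_linked_induced; exists y' => //.
  apply/mem_linked_induced; exists z => //.
  apply/mem_linked_induced; exists x => //.
  by rewrite mem_rcoset mulgV -(mulg1 1) mem_mulg ?group1.
case/rcosetP=> _ /mulsgP[u v uN vN ->] x'E.
rewrite Rsym x'E mem_linked_group in Ry'x' uN.
have Rv : R i j v (y' * y^-1).
  have := Rdiv (RM (RV uN) Ry'x') Rxy.
  by rewrite invg1 mul1g -(mulgA u) mulKg mulgK.
(* The error [y' * y^-1] is [p * q] with q related to 1 over k. The factor p, related to 1 over i,
   has a partner m over k that is also related to 1 over i. *)
have /mulsgP[p q pN qN pqE] := Rker vN Rv.
have [w Rpw] := Rtotal k p.
have /mulsgP[n m nN mN wE] := Rker pN Rpw.
rewrite !mem_linked_group in pN qN nN mN.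
(* Dividing by m leaves the relation to x intact and replaces y' by [p^-1 * y']; dividing further by
   q gives y. *)
exists (m^-1 * z).
  by rewrite Rsym -[x]mul1g -invg1; apply: RM; [apply: RV | rewrite Rsym].
have Rmp : R k j m p.
  rewrite -(mulKg n m) -wE -[p]mul1g -invg1; apply: RM; first exact: RV.
  by rewrite Rsym.
have : R k j (1^-1 * (m^-1 * z)) (q^-1 * (p^-1 * y')).
  by apply: RM; [apply: RV; rewrite Rsym | apply: RM; first apply: RV].
by rewrite invg1 mul1g !mulgA -invMg -pqE invMg invgK mulgKV.
Qed.

Lemma linkage_of_linked : linkage (system_rel F).
Proof.
split=> // i x y; have [_ N1 _ [f1 _] _] := LF.
by rewrite /system_rel f1 ?mem_cosets // mem_rcoset N1 in_set1 -eq_mulgV1 eq_sym.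
Qed.

Lemma system_rel_represents : represents (system_rel F) F.
Proof.
by split=> i j => [|x]; apply/setP=> ?; rewrite ?mem_linked_group inE.
Qed.

End LinkageOfLinked.

End Linkages.

(** * Basis relations of a coherent configuration *)

Section CoherentConfiguration.

Variables (Om : finType) (S : {set {set Om * Om}}).
Implicit Types (r s t : {set Om * Om}) (a b c : Om) (p : Om * Om).

Lemma mem_compose r s a b :
  reflect (exists2 c, (a, c) \in r & (c, b) \in s) ((a, b) \in compose r s).
Proof.
rewrite inE; apply: (iffP existsP) => [[c /andP[]]|[c rc sc]]; first by exists c.
by exists c; rewrite rc.
Qed.

Lemma mem_converse s a b : ((a, b) \in converse s) = ((b, a) \in s).
Proof.
apply/imsetP/idP => [[[c d] sp /= [-> ->]] //|sba].
by exists (b, a).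
Qed.

Lemma mem_diag (D : {set Om}) a b : ((a, b) \in diag D) = (a \in D) && (a == b).
Proof.
apply/imsetP/andP => [[c Dc [-> ->]] //|[Da /eqP <-]]; by exists a.
Qed.

Hypothesis cohS : coherent S.

Lemma basis_uniq s t p : s \in S -> t \in S -> p \in s -> p \in t -> s = t.
Proof.
case: cohS => /and3P[_ trS _] _ _ _ Ss St ps pt.
by rewrite -(def_pblock trS Ss ps) (def_pblock trS St pt).
Qed.

Lemma basis_pblock p : pblock S p \in S /\ p \in pblock S p.
Proof.
case: cohS => /and3P[/eqP covS _ _] _ _ _.
by split; [apply: pblock_mem | rewrite mem_pblock]; rewrite covS inE.
Qed.

Lemma basis_neq0 s : s \in S -> exists p, p \in s.
Proof.
case: cohS => /and3P[_ _ S0] _ _ _ Ss; apply/set0Pn.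
by apply: contraNneq S0 => <-.
Qed.

Lemma basis_converse s : s \in S -> converse s \in S.
Proof. by case: cohS => _ _ + _; apply. Qed.

(** The intersection number of r and s is positive at p, hence at every pair of t. *)
Lemma basis_sub_compose r s t p : r \in S -> s \in S -> t \in S ->
  p \in t -> p \in compose r s -> t \subset compose r s.
Proof.
case: cohS => _ _ _ intS Sr Ss St pt; rewrite (surjective_pairing p).
case/mem_compose=> c rc sc; apply/subsetP=> q qt.
have : (0 < #|neighbours q.1 r :&: neighbours q.2 (converse s)|)%N.
  rewrite -(intS r s t _ _ _ p) // card_gt0; apply/set0Pn; exists c.
  by rewrite !inE mem_converse rc.
rewrite card_gt0 => /set0Pn[d]; rewrite !inE mem_converse => /andP[rd sd].
by apply/existsP; exists d; rewrite rd.
Qed.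

(** The basis relation through (a, a) used in the decomposition of the diagonal consists of diagonal
    pairs only. *)
Lemma basis_diag a : exists2 D : {set Om}, a \in D & diag D \in S.
Proof.
case: (cohS) => _ [T /subsetP sTS diagT] _ _.
have : (a, a) \in diag [set: Om] by rewrite mem_diag inE eqxx.
rewrite diagT => /bigcupP[s sT sa]; exists [set b | (b, b) \in s].
  by rewrite inE.
suff -> : diag [set b | (b, b) \in s] = s by apply: sTS.
apply/setP=> [[b c]]; rewrite mem_diag inE.
apply/andP/idP => [[sb /eqP <-] //|sbc].
have : (b, c) \in diag [set: Om] by rewrite diagT; apply/bigcupP; exists s.
by rewrite mem_diag => /andP[_ /eqP eq_bc]; rewrite -eq_bc in sbc *.
Qed.

End CoherentConfiguration.

Section Configuration.

Variables (I : finType) (gT : I -> finGroupType).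

(** * Fibers of a quasiregular configuration and the group action on them *)

Section QuasiregularConfiguration.

Local Open Scope group_scope.

Variable X : qr_config gT.
Implicit Types (u v w : X) (s : {set X * X}).

Let cohS := qc_coherent X.

Lemma diag_qc_fiber i : diag (qc_fiber X i) \in qc_basis X.
Proof. by apply/qc_fiberP; exists i. Qed.

Lemma qc_fiber_cover u : exists i, u \in qc_fiber X i.
Proof.
by have [D Du /qc_fiberP[i eqD]] := basis_diag cohS u; exists i; rewrite -eqD.
Qed.

Lemma qc_fiber_uniq u i j :
  u \in qc_fiber X i -> u \in qc_fiber X j -> i = j.
Proof.
move=> iu ju; apply: (@qc_fiber_inj _ _ X).
have /setP eq_diag : diag (qc_fiber X i) = diag (qc_fiber X j).
  by apply: (@basis_uniq _ _ cohS _ _ (u, u));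
    rewrite ?diag_qc_fiber // mem_diag ?iu ?ju eqxx.
by apply/setP=> v; have := eq_diag (v, v); rewrite !mem_diag eqxx !andbT.
Qed.

(** If s meets a fiber on the left, then s is contained in the composition of the diagonal of that
    fiber with s; the right side follows by taking converses. *)
Lemma basis_fibers s u v u' v' i j : s \in qc_basis X ->
    (u, v) \in s -> (u', v') \in s ->
    u \in qc_fiber X i -> v \in qc_fiber X j ->
  u' \in qc_fiber X i /\ v' \in qc_fiber X j.
Proof.
have left_fiber t k w z w' z' : t \in qc_basis X ->
  (w, z) \in t -> (w', z') \in t -> w \in qc_fiber X k -> w' \in qc_fiber X k.
  move=> St twz tw'z' kw.
  have /subsetP/(_ _ tw'z')/mem_compose[w1] :
      t \subset compose (diag (qc_fiber X k)) t.
    apply: (@basis_sub_compose _ _ cohS _ _ _ (w, z)); rewrite ?diag_qc_fiber //.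
    by apply/mem_compose; exists w; rewrite ?mem_diag ?kw ?eqxx.
  by rewrite mem_diag => /andP[].
move=> Ss suv su'v' iu jv; split; first exact: left_fiber suv su'v' iu.
by apply: left_fiber (basis_converse cohS Ss) (_ : (v, u) \in _)
  (_ : (v', u') \in _) jv; rewrite mem_converse.
Qed.

Lemma qc_rel_inside i (x : gT i) :
  qc_rel X x \in inside (qc_basis X) (qc_fiber X i).
Proof. by rewrite -qc_rel_im imset_f. Qed.

Lemma qc_rel_basis i (x : gT i) : qc_rel X x \in qc_basis X.
Proof. by have := qc_rel_inside x; rewrite inE => /andP[]. Qed.

Lemma qc_rel_fiber i (x : gT i) u v :
  (u, v) \in qc_rel X x -> (u \in qc_fiber X i) && (v \in qc_fiber X i).
Proof.
have := qc_rel_inside x; rewrite inE => /andP[_ /subsetP sx] /sx.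
by rewrite inE.
Qed.

Lemma qc_rel_functional i (x : gT i) u v w :
  (u, v) \in qc_rel X x -> (u, w) \in qc_rel X x -> v = w.
Proof.
have fibi : fiber (qc_basis X) (qc_fiber X i) by apply: diag_qc_fiber.
have [/card_le1_eqP + _] := qc_quasiregular fibi (qc_rel_inside x) u.
by move=> inj xv xw; apply: inj; rewrite inE.
Qed.

(** A basis relation is nonempty, so some point of the fiber starts an edge; [basis_sub_compose]
    then spreads this along the diagonal of the fiber. *)
Lemma qc_rel_total i (x : gT i) u :
  u \in qc_fiber X i -> exists v, (u, v) \in qc_rel X x.
Proof.
move=> iu; have [[v w] xvw] := basis_neq0 cohS (qc_rel_basis x).
have /andP[iv _] := qc_rel_fiber xvw.
have : diag (qc_fiber X i) \subset compose (qc_rel X x) (converse (qc_rel X x)).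
  apply: (basis_sub_compose cohS _ _ _ (_ : (v, v) \in _));
    rewrite ?basis_converse ?diag_qc_fiber ?qc_rel_basis ?mem_diag ?iv ?eqxx //.
  by apply/mem_compose; exists w; rewrite ?mem_converse.
move/subsetP/(_ (u, u)); rewrite mem_diag iu eqxx => /(_ isT)/mem_compose[z].
by exists z.
Qed.

Lemma qc_rel_comp i (x y : gT i) u v w :
  (u, v) \in qc_rel X x -> (v, w) \in qc_rel X y -> (u, w) \in qc_rel X (x * y).
Proof. by move=> xuv yvw; rewrite qc_relM; apply/mem_compose; exists v. Qed.

Lemma qc_relP i u v : u \in qc_fiber X i -> v \in qc_fiber X i ->
  exists x : gT i, (u, v) \in qc_rel X x.
Proof.
move=> iu iv; have [Sp pp] := basis_pblock cohS (u, v).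
have : pblock (qc_basis X) (u, v) \in inside (qc_basis X) (qc_fiber X i).
  rewrite inE Sp; apply/subsetP=> [[u' v'] p'].
  by rewrite inE; apply/andP/(basis_fibers Sp pp p' iu iv).
by rewrite -qc_rel_im => /imsetP[x _ eqx]; exists x; rewrite -eqx.
Qed.

Lemma qc_rel_uniq i (x y : gT i) u v :
  (u, v) \in qc_rel X x -> (u, v) \in qc_rel X y -> x = y.
Proof.
by move=> xuv yuv; apply/(@qc_rel_inj _ _ X i)/(basis_uniq cohS _ _ xuv yuv);
  apply: qc_rel_basis.
Qed.

(** * Coordinates given by base points, and the linkage of a configuration *)

Section BasePoints.

Variable a : I -> X.
Hypothesis base_a : base_points a.

(** The point written a_i x above. For base points the default [a i] is never taken, see
    [base_point_rel]. *)
Definition point i (x : gT i) : X :=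
  odflt (a i) [pick v | (a i, v) \in qc_rel X x].

Lemma base_point_rel i (x : gT i) : (a i, point x) \in qc_rel X x.
Proof.
rewrite /point; case: pickP => //= none.
by have [v xv] := qc_rel_total x (base_a i); have := none v; rewrite xv.
Qed.

Lemma point_fiber i (x : gT i) : point x \in qc_fiber X i.
Proof. by have /andP[] := qc_rel_fiber (base_point_rel x). Qed.

Lemma point_surj i u : u \in qc_fiber X i -> exists x : gT i, u = point x.
Proof.
case/(qc_relP (base_a i))=> x xu; exists x.
by apply: qc_rel_functional xu (base_point_rel x).
Qed.

Lemma qc_rel_point i (x y z : gT i) :
  ((point x, point y) \in qc_rel X z) = (y == x * z).
Proof.
apply/idP/eqP => [zxy|->].
  apply: qc_rel_uniq (base_point_rel y) _.
  by apply: qc_rel_comp zxy; apply: base_point_rel.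
have [v zxv] := qc_rel_total z (point_fiber x).
suff -> : point (x * z) = v by [].
apply: qc_rel_functional (base_point_rel _) _.
by apply: qc_rel_comp zxv; apply: base_point_rel.
Qed.

Lemma qc_rel1 i : qc_rel X (1 : gT i) = diag (qc_fiber X i).
Proof.
apply: (@basis_uniq _ _ cohS _ _ (point (1 : gT i), point (1 : gT i))).
- exact: qc_rel_basis.
- exact: diag_qc_fiber.
- by rewrite qc_rel_point mulg1.
- by rewrite mem_diag point_fiber eqxx.
Qed.

Lemma point1 i : point (1 : gT i) = a i.
Proof.
by have := base_point_rel (1 : gT i); rewrite qc_rel1 mem_diag => /andP[_ /eqP].
Qed.

Lemma point_inj i : injective (@point i).
Proof.
move=> x y eq_xy; apply: qc_rel_uniq (base_point_rel x) _.
by rewrite eq_xy; apply: base_point_rel.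
Qed.

Lemma point_cover u : exists i (x : gT i), u = point x.
Proof.
by have [i iu] := qc_fiber_cover u; exists i; apply: point_surj.
Qed.

(* Identifying the fibers with the groups through the base points, base_rel a i j
   becomes a relation between gT i and gT j: the union of the products C * f_ij C
   over the cosets C of G_ij. *)
Definition config_rel : fiber_rel gT :=
  fun i j x y => (point x, point y) \in base_rel a i j.

Let base_relP i j : base_rel a i j \in qc_basis X
  /\ (point (1 : gT i), point (1 : gT j)) \in base_rel a i j.
Proof. by rewrite !point1; apply: basis_pblock. Qed.

(** The relation s is [base_rel a i j] followed by right multiplication by [y0]: each of the two is
    contained in the composition of the other with the relation of [y0] or of its inverse, because
    they agree at one pair. *)
Lemma mem_basis_point s i j (x : gT i) (y y0 : gT j) : s \in qc_basis X ->
    (point (1 : gT i), point y0) \in s ->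
  ((point x, point y) \in s) = config_rel x (y * y0^-1).
Proof.
move=> Ss s0; have [Sij ij1] := base_relP i j.
apply/idP/idP => [sxy|].
  have /subsetP/(_ _ sxy)/mem_compose[u xu] :
      s \subset compose (base_rel a i j) (qc_rel X y0).
    apply: (basis_sub_compose cohS _ _ _ s0); rewrite ?qc_rel_basis //.
    by apply/mem_compose; exists (point (1 : gT j)); rewrite ?qc_rel_point ?mul1g.
  move=> yu; have /andP[/point_surj[z uE] _] := qc_rel_fiber yu.
  by move: xu yu; rewrite uE qc_rel_point => xz /eqP ->; rewrite mulgK.
move=> Rxy.
have /subsetP/(_ _ Rxy)/mem_compose[u xu] :
    base_rel a i j \subset compose s (qc_rel X y0^-1).
  apply: (basis_sub_compose cohS _ _ _ ij1); rewrite ?qc_rel_basis //.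
  by apply/mem_compose; exists (point y0); rewrite ?qc_rel_point ?mulgV.
move=> yu; have /andP[/point_surj[z uE] _] := qc_rel_fiber yu.
move: xu yu; rewrite uE qc_rel_point => xz /eqP/mulIg ->.
by [].
Qed.

Lemma basis_pointE s i j (y0 : gT j) : s \in qc_basis X ->
    (point (1 : gT i), point y0) \in s ->
  s = [set (point xy.1, point xy.2)
       | xy in [set xy : gT i * gT j | config_rel xy.1 (xy.2 * y0^-1)]].
Proof.
move=> Ss s0; apply/setP=> [[u v]]; apply/idP/imsetP => [suv|].
  have [] := basis_fibers Ss s0 suv (point_fiber 1) (point_fiber y0).
  move=> /point_surj[x uE] /point_surj[y vE]; exists (x, y); last by rewrite uE vE.
  by rewrite inE -(mem_basis_point _ _ Ss s0) -uE -vE.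
by case=> [[x y]]; rewrite inE -(mem_basis_point _ _ Ss s0) => sxy [-> ->].
Qed.

(** As in [qc_rel_total], one edge starting in a fiber forces an edge at every point of it, in
    particular at the base point. *)
Lemma basis_point s : s \in qc_basis X ->
  exists i j (y0 : gT j), (point (1 : gT i), point y0) \in s.
Proof.
move=> Ss; have [[u v] suv] := basis_neq0 cohS Ss.
have [i [x uE]] := point_cover u.
have iu : u \in qc_fiber X i by rewrite uE point_fiber.
have : diag (qc_fiber X i) \subset compose s (converse s).
  apply: (basis_sub_compose cohS _ _ _ (_ : (u, u) \in _));
    rewrite ?basis_converse ?diag_qc_fiber ?mem_diag ?iu ?eqxx //.
  by apply/mem_compose; exists v; rewrite ?mem_converse.
move/subsetP/(_ (point (1 : gT i), point (1 : gT i))).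
rewrite mem_diag point_fiber eqxx => /(_ isT)/mem_compose[w s1w _].
by have [j [y0 wE]] := point_cover w; exists i, j, y0; rewrite -wE.
Qed.

Lemma qc_fiber_point i : qc_fiber X i = [set point x | x in [set: gT i]].
Proof.
apply/setP=> u; apply/idP/imsetP => [/point_surj[x ->]|[x _ ->]].
  by exists x.
exact: point_fiber.
Qed.

Lemma tagged_point_inj :
  injective (fun k : {i : I & gT i} => point (tagged k)).
Proof.
move=> [i x] [j y] /= eq_xy.
have eq_ij : i = j.
  by apply: qc_fiber_uniq (point_fiber x) _; rewrite eq_xy point_fiber.
by case: j / eq_ij y eq_xy => y /point_inj ->.
Qed.

Lemma mem_base_rel_fiber i j u v : (u, v) \in base_rel a i j ->
  (u \in qc_fiber X i) /\ (v \in qc_fiber X j).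
Proof.
have [Sij ij1] := base_relP i j => uv.
exact: basis_fibers ij1 uv (point_fiber 1) (point_fiber 1).
Qed.

Lemma base_rel_converse i j : base_rel a j i = converse (base_rel a i j).
Proof.
have [[Sij ij1] [Sji ji1]] := (base_relP i j, base_relP j i).
apply: (basis_uniq cohS _ _ ji1); rewrite ?basis_converse //.
by rewrite mem_converse.
Qed.

Lemma base_rel_sub_compose i j k :
  base_rel a i j \subset compose (base_rel a i k) (base_rel a k j).
Proof.
have [[Sij ij1] [Sik ik1]] := (base_relP i j, base_relP i k).
have [Skj kj1] := base_relP k j.
by apply: (basis_sub_compose cohS _ _ _ ij1) => //;
  apply/mem_compose; exists (point (1 : gT k)).
Qed.

Lemma config_rel_linkage : linkage config_rel.
Proof.
split.
- move=> i x y; have [Sii ii1] := base_relP i i.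
  rewrite /config_rel; have -> : base_rel a i i = qc_rel X (1 : gT i).
    by apply: (basis_uniq cohS _ _ ii1); rewrite ?qc_rel_basis // qc_rel_point mulg1.
  by rewrite qc_rel_point mulg1 eq_sym.
- by move=> i j x y; rewrite /config_rel (base_rel_converse i) mem_converse.
- move=> i j x; have [Sij ij1] := base_relP i j.
  have : diag (qc_fiber X i)
      \subset compose (base_rel a i j) (converse (base_rel a i j)).
    apply: (basis_sub_compose cohS _ _ _
      (_ : (point (1 : gT i), point (1 : gT i)) \in _));
      rewrite ?basis_converse ?diag_qc_fiber ?mem_diag ?point_fiber ?eqxx //.
    by apply/mem_compose; exists (point (1 : gT j)); rewrite ?mem_converse.
  move/subsetP/(_ (point x, point x)); rewrite mem_diag point_fiber eqxx.
  case/(_ isT)/mem_compose=> u xu _.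
  have [_ /point_surj[y uE]] := mem_base_rel_fiber xu.
  by exists y; rewrite /config_rel -uE.
- move=> i j x y x' y' Rxy Rxy'; have [Sij ij1] := base_relP i j.
  (* The path a_i, a_i x', a_j y' puts t inside the composition of [qc_rel X x'] and s_ij. Reading
     this at the pair with coordinates x and [y * y'], which is in t, gives the product. *)
  have [St t0] := basis_pblock cohS (point (1 : gT i), point y').
  set t := pblock _ _ in St t0.
  have /subsetP/(_ (point x, point (y * y')))/(_ _)/mem_compose[] :
      t \subset compose (qc_rel X x') (base_rel a i j).
  + apply: (basis_sub_compose cohS _ _ _ t0); rewrite ?qc_rel_basis //.
    by apply/mem_compose; exists (point x'); rewrite ?qc_rel_point ?mul1g.
  + by rewrite (mem_basis_point _ _ St t0) mulgK.
  move=> u xu; have /andP[_ /point_surj[z uE]] := qc_rel_fiber xu.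
  by move: xu; rewrite uE qc_rel_point => /eqP ->.
move=> i j k x y /(subsetP (base_rel_sub_compose i j k))/mem_compose[u xu uy].
have [_ /point_surj[z uE]] := mem_base_rel_fiber xu.
by exists z; rewrite /config_rel -uE.
Qed.

Let LR := config_rel_linkage.
Let RM := linkage_mul LR.

Lemma complex_product1 s t (T : {set {set X * X}}) :
  (s \in complex_product (qc_basis X) T [set t])
  = (s \in qc_basis X) && [exists r in T, s \subset compose r t].
Proof.
apply/bigcupP/andP => [[r rT]|[Ss /existsP[r /andP[rT rs]]]].
  by rewrite big_set1 inE => /andP[Ss rs]; split=> //; apply/existsP; exists r;
    rewrite rT.
by exists r; rewrite ?big_set1 // inE Ss.
Qed.

Lemma qd_sub_system_of i j :
  qd_sub (system_of a) i j = [set x | config_rel x (1 : gT j)].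
Proof.
apply/setP=> x; rewrite !inE complex_product1 qc_rel_basis /=.
have [Sij ij1] := base_relP i j.
apply/existsP/idP => [[r /andP[/set1P -> /subsetP sub_x]]|Rx1].
  have /mem_compose[u] := sub_x _ (base_point_rel x).
  rewrite -point1 mem_converse => R1u Rxu.
  have [_ /point_surj[y uE]] := mem_base_rel_fiber Rxu.
  rewrite uE in R1u Rxu.
  by have := RM Rxu (mul_closedV RM R1u); rewrite mulgV invg1 mulg1.
exists (base_rel a i j); rewrite set11.
apply: (basis_sub_compose cohS _ _ _ (base_point_rel x));
  rewrite ?qc_rel_basis ?basis_converse //.
by apply/mem_compose; exists (point (1 : gT j)); rewrite -?point1 ?mem_converse.
Qed.

Lemma config_rel_represents : represents config_rel (system_of a).
Proof.
split=> [|i j x0]; first exact: qd_sub_system_of.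
rewrite qd_sub_system_of; apply/setP=> y.
rewrite !inE complex_product1 qc_rel_basis /=.
have [[Sij ij1] Sij'] := (base_relP i j, basis_converse cohS (base_relP i j).1).
apply/existsP/idP => [[r]|Rxy].
  case/andP=> /bigcupP[s' /set1P ->{s'} /bigcupP[t]].
  case/imsetP=> _ /rcosetP[n + ->] ->{t}; rewrite !inE => Rn1 /andP[Sr r_sub].
  move/subsetP/(_ _ (base_point_rel y)) => /mem_compose[u /(subsetP r_sub)].
  case/mem_compose=> v; rewrite mem_converse -point1 => Rv1 vu Ruy.
  have [/point_surj[z vE] _] := mem_base_rel_fiber Rv1.
  have [/point_surj[w uE] _] := mem_base_rel_fiber Ruy.
  move: vu; rewrite vE uE qc_rel_point => /eqP wE.
  rewrite uE wE -[_ \in _]/(config_rel _ _) in Ruy.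
  rewrite vE -[_ \in _]/(config_rel _ _) in Rv1.
  (* The path runs through a_i z and a_i z n x0 with z and n both related to 1; cancelling [z * n]
     leaves x0 related to y. *)
  have := RM (mul_closedV RM (RM Rv1 Rn1)) Ruy.
  by rewrite (mulgA z) mulKg mulg1 invg1 mul1g.
(* The witness is the basis relation of the pair a_j, a_i x0, reached through a_i. *)
have [Sr r1] := basis_pblock cohS (point (1 : gT j), point x0).
set r := pblock _ _ in Sr r1.
exists r; apply/andP; split.
  apply/bigcupP; exists (converse (base_rel a i j)); first exact: set11.
  apply/bigcupP; exists (qc_rel X x0).
    by rewrite imset_f // mem_rcoset mulgV inE (linkage1 _ _ LR).
  rewrite inE Sr; apply: (basis_sub_compose cohS _ _ _ r1); rewrite ?qc_rel_basis //.
  apply/mem_compose; exists (point (1 : gT i)); first by rewrite mem_converse.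
  by rewrite qc_rel_point mul1g.
apply: (basis_sub_compose cohS _ _ _ (base_point_rel y)); rewrite ?qc_rel_basis //.
by apply/mem_compose; exists (point x0); rewrite -?point1.
Qed.

End BasePoints.

End QuasiregularConfiguration.

(** Equal linkages make the bijection preserving coordinates an isomorphism, by [basis_pointE].
    Conversely, a based isomorphism preserves coordinates, since these are defined from the base
    points and [qc_rel]. *)
Lemma config_rel_iso (X Y : qr_config gT) (a : I -> X) (b : I -> Y) :
    base_points a -> base_points b ->
  (forall i j x y, @config_rel X a i j x y = @config_rel Y b i j x y)
  <-> based_iso a b.
Proof.
move=> base_a base_b; split=> [eqR|[phi [phi_bij basisY _ relY phi_a]]].
  have coord (Z : qr_config gT) (c : I -> Z) : base_points c ->
      exists e : Z -> {i : I & gT i}, forall u, u = point c (tagged (e u)).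
    move=> base_c.
    apply: (fin_all_exists (P := fun u k => u = point c (tagged k))) => u.
    by have [i [x uE]] := point_cover base_c u; exists (Tagged gT x).
  have [e eK] := coord X a base_a; have [e' e'K] := coord Y b base_b.
  have e_pt i (x : gT i) : e (point a x) = Tagged gT x.
    by apply: (tagged_point_inj base_a); rewrite -eK.
  have e'_pt i (x : gT i) : e' (point b x) = Tagged gT x.
    by apply: (tagged_point_inj base_b); rewrite -e'K.
  pose phi u := point b (tagged (e u)).
  have phi_pt i (x : gT i) : phi (point a x) = point b x by rewrite /phi e_pt.
  pose phi2 (s : {set X * X}) := [set (phi p.1, phi p.2) | p in s].
  have phi2E i j (y0 : gT j) s t :
      s \in qc_basis X -> (point a (1 : gT i), point a y0) \in s ->
      t \in qc_basis Y -> (point b (1 : gT i), point b y0) \in t -> phi2 s = t.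
    move=> Ss s0 St t0; rewrite /phi2 (basis_pointE base_a Ss s0).
    rewrite (basis_pointE base_b St t0) -imset_comp.
    have -> : [set xy : gT i * gT j | config_rel b xy.1 (xy.2 * y0^-1)%g]
      = [set xy | config_rel a xy.1 (xy.2 * y0^-1)%g].
      by apply/setP=> xy; rewrite !inE eqR.
    by apply: eq_imset => xy /=; rewrite !phi_pt.
  exists phi; split.
  - exists (fun v => point a (tagged (e' v))) => [u|v].
      by rewrite [in LHS]/phi e'_pt -eK.
    by rewrite phi_pt -e'K.
  - apply/setP=> t; apply/idP/imsetP => [St|[s Ss ->]].
      have [i [j [y0 t0]]] := basis_point base_b St.
      have [Ss s0] := basis_pblock (qc_coherent X) (point a (1%g : gT i), point a y0).
      exists (pblock (qc_basis X) (point a (1%g : gT i), point a y0)) => //.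
      by rewrite -(phi2E _ _ _ _ _ Ss s0 St t0).
    have [i [j [y0 s0]]] := basis_point base_a Ss.
    have [St t0] := basis_pblock (qc_coherent Y) (point b (1%g : gT i), point b y0).
    by rewrite -/(phi2 s) (phi2E _ _ _ _ _ Ss s0 St t0).
  - move=> i; rewrite (qc_fiber_point base_a) (qc_fiber_point base_b) -imset_comp.
    by apply: eq_imset => x /=; rewrite phi_pt.
  - move=> i x; apply/esym/(phi2E i i x); rewrite ?qc_rel_basis //.
      by rewrite (qc_rel_point base_a) mul1g.
    by rewrite (qc_rel_point base_b) mul1g.
  - by move=> i; rewrite -(point1 base_a) -(point1 base_b) phi_pt.
have phi_inj := bij_inj phi_bij.
have phi2_inj : injective (fun p : X * X => (phi p.1, phi p.2)).
  by move=> [u v] [u' v'] /= [/phi_inj -> /phi_inj ->].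
have phi_pt i (x : gT i) : phi (point a x) = point b x.
  apply: (@qc_rel_functional Y i x (b i)); last exact: base_point_rel.
  rewrite relY -phi_a.
  exact: (imset_f (fun p => (phi p.1, phi p.2)) (base_point_rel base_a x)).
move=> i j x y; rewrite /config_rel.
have -> : base_rel b i j = [set (phi p.1, phi p.2) | p in base_rel a i j].
  have [SX pX] := basis_pblock (qc_coherent X) (a i, a j).
  have [SY pY] := basis_pblock (qc_coherent Y) (b i, b j).
  apply: (basis_uniq (qc_coherent Y) SY _ pY).
    by rewrite basisY imset_f.
  by rewrite -!phi_a (imset_f (fun p => (phi p.1, phi p.2)) pX).
by rewrite -!phi_pt (mem_imset _ (_, _) phi2_inj).
Qed.

End Configuration.

(** * The configuration constructed from a linkage *)

Section Construction.

Local Open Scope group_scope.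

Variables (I : finType) (gT : I -> finGroupType) (R : fiber_rel gT).
Arguments R : clear implicits.
Hypothesis LR : linkage R.

Let RM := linkage_mul LR.
Let R1 i j : R i j 1 1 := linkage1 i j LR.
Let RV i j x y : R i j x y -> R i j x^-1 y^-1 := @mul_closedV _ _ _ i j x y RM.

Let pt : finType := {i : I & gT i}.
Implicit Types (u v : pt) (p q : pt * pt) (W : forall i, gT i).

Definition shift W u : pt := Tagged gT (W (tag u) * tagged u).

Definition shift2 W p := (shift W p.1, shift W p.2).

(* The orbit of p under the subgroup R i j of gT i * gT j acting by left
   translations.  Quantifying over whole families W avoids casts between the
   groups of equal tags; since R i i is the identity, this is no restriction,
   see [linkage_family]. *)
Definition orbit_rel p : {set pt * pt} :=
  [set q | [exists W : {dffun forall i, gT i},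
     R (tag p.1) (tag p.2) (W (tag p.1)) (W (tag p.2)) && (q == shift2 W p)]].

Definition orbit_basis := [set orbit_rel p | p in [set: pt * pt]].

Lemma shiftM W W' u : shift W (shift W' u) = shift (fun i => W i * W' i) u.
Proof. by rewrite /shift /= mulgA. Qed.

Lemma shift1 u : shift (fun=> 1) u = u.
Proof. by case: u => i x; rewrite /shift /= mul1g. Qed.

Lemma shiftK W : cancel (shift W) (shift (fun i => (W i)^-1)).
Proof. by case=> i x; rewrite /shift /= mulKg. Qed.

Lemma mem_orbit_rel p q :
  reflect (exists2 W : forall i, gT i,
                      R (tag p.1) (tag p.2) (W (tag p.1)) (W (tag p.2))
                      & q = shift2 W p)
          (q \in orbit_rel p).
Proof.
rewrite inE; apply: (iffP existsP) => [[W /andP[RW /eqP ->]]|[W RW ->]].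
  by exists W.
exists [ffun i => W i]; rewrite !ffunE RW /=.
by rewrite /shift2 /shift !ffunE.
Qed.

Lemma orbit_rel_refl p : p \in orbit_rel p.
Proof.
apply/mem_orbit_rel; exists (fun=> 1) => //.
by rewrite /shift2 !shift1 -surjective_pairing.
Qed.

Lemma orbit_rel_eq p q : q \in orbit_rel p -> orbit_rel q = orbit_rel p.
Proof.
case/mem_orbit_rel=> W RW qE.
apply/setP=> r; apply/mem_orbit_rel/mem_orbit_rel => [[W' RW' ->]|[W' RW' ->]].
  exists (fun i => W' i * W i); rewrite qE /= in RW' *; first exact: RM.
  by rewrite /shift2 /= !shiftM.
exists (fun i => W' i * (W i)^-1); rewrite qE /=; first by apply: RM => //; apply: RV.
by rewrite /shift2 /= !shiftM /shift /= !mulgKV.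
Qed.

Lemma mem_orbit_basis s p : s \in orbit_basis -> p \in s -> s = orbit_rel p.
Proof. by case/imsetP=> q _ -> /orbit_rel_eq. Qed.

Lemma orbit_basisT p : orbit_rel p \in orbit_basis.
Proof. exact: imset_f. Qed.

Lemma orbit_basis_partition : partition orbit_basis [set: pt * pt].
Proof.
apply/and3P; split.
- apply/eqP/setP=> p; rewrite inE; apply/bigcupP.
  by exists (orbit_rel p); rewrite ?orbit_basisT ?orbit_rel_refl.
- apply/trivIsetP=> s t Ss St; apply: contraNT => /pred0Pn[p /andP[/= sp tp]].
  by rewrite (mem_orbit_basis Ss sp) (mem_orbit_basis St tp).
- apply/imsetP=> [[p _ p0]].
  by have := orbit_rel_refl p; rewrite -p0 inE.
Qed.

(* W k is the same element for both pairs (i, k) and (k, j), so shifting by W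
   moves a whole triangle of points with tags i, k, j within its three orbits:
   this is what makes the intersection numbers constant. *)
Lemma linkage_family i j g h : R i j g h ->
  exists W : forall k, gT k,
    [/\ W i = g, W j = h & forall k, R i k g (W k) /\ R k j (W k) h].
Proof.
move=> Rgh.
have [W WP] : exists W : forall k, gT k, forall k, R i k g (W k) /\ R k j (W k) h.
  apply: (fin_all_exists (P := fun k w => R i k g w /\ R k j w h)) => k.
  by have [w Rgw Rwh] := linkage_comp LR k Rgh; exists w.
exists W; split=> //.
  by have [+ _] := WP i; rewrite (linkage_id LR) => /eqP.
by have [_] := WP j; rewrite (linkage_id LR) => /eqP.
Qed.

(** [linkage_family] provides a family with prescribed values at i and j even when i and j
    coincide. *)
Lemma orbit_rel_Tagged i j (x x' : gT i) (y y' : gT j) :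
  ((Tagged gT x', Tagged gT y') \in orbit_rel (Tagged gT x, Tagged gT y))
  = R i j (x' * x^-1) (y' * y^-1).
Proof.
apply/mem_orbit_rel/idP => [[W /= RW []]|Rxy].
  by move=> /eqP + /eqP; rewrite !eq_Tagged /= => /eqP -> /eqP ->; rewrite !mulgK.
have [W [Wi Wj _]] := linkage_family Rxy; exists W; first by rewrite /= Wi Wj.
by rewrite /shift2 /shift /= Wi Wj !mulgKV.
Qed.

Definition orbit_fiber i : {set pt} := [set u | tag u == i].

Lemma diag_orbit_fiber u : diag (orbit_fiber (tag u)) = orbit_rel (u, u).
Proof.
case: u => i x; apply/setP=> [[v w]]; rewrite mem_diag inE.
apply/andP/idP => [[/= /eqP]|/mem_orbit_rel[W _ [-> ->]]]; last by rewrite !eqxx.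
case: v => k y /= eq_k /eqP <-; case: i / eq_k x => x.
by rewrite orbit_rel_Tagged (linkage_id LR).
Qed.

Lemma orbit_basis_coherent : coherent orbit_basis.
Proof.
split.
- exact: orbit_basis_partition.
- exists [set orbit_rel (u, u) | u in [set: pt]].
    by apply/subsetP=> _ /imsetP[u _ ->]; apply: orbit_basisT.
  apply/setP=> [[u v]]; rewrite mem_diag inE /=.
  apply/eqP/bigcupP => [<-|[_ /imsetP[w _ ->]]].
    exists (orbit_rel (u, u)); last exact: orbit_rel_refl.
    exact: (imset_f (fun w => orbit_rel (w, w))).
  by case/mem_orbit_rel=> W _ [-> ->].
- have conv_sub p q : q \in orbit_rel p -> (q.2, q.1) \in orbit_rel (p.2, p.1).
    case/mem_orbit_rel=> W RW ->; apply/mem_orbit_rel; exists W => //=.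
    by rewrite (linkage_sym LR).
  move=> _ /imsetP[p _ ->].
  suff -> : converse (orbit_rel p) = orbit_rel (p.2, p.1).
    exact: orbit_basisT.
  apply/setP=> [[u v]]; rewrite mem_converse.
  apply/idP/idP => /conv_sub //=; by rewrite -surjective_pairing.
move=> r s t Sr Ss St p q pt_t qt.
(* By symmetry an inequality suffices, and it comes from an injection of common neighbours. *)
suff le_card p' q' : p' \in t -> q' \in t ->
    (#|neighbours p'.1 r :&: neighbours p'.2 (converse s)|
     <= #|neighbours q'.1 r :&: neighbours q'.2 (converse s)|)%N.
  by apply/eqP; rewrite eqn_leq !le_card.
move=> tp; rewrite (mem_orbit_basis St tp) => /mem_orbit_rel[W0].
(* [W0] is constrained only at the tags of p'. It is replaced by a family with the same two values
   that is compatible at every third tag. *)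
case/linkage_family=> W [W1 W2 WP] q'E.
have {}q'E : q' = shift2 W p' by rewrite q'E /shift2 /shift W1 W2.
rewrite -(card_imset _ (can_inj (shiftK W))).
apply/subset_leq_card/subsetP=> _ /imsetP[c + ->].
rewrite !inE !mem_converse => /andP[rc sc].
have [Rc1 Rc2] := WP (tag c); rewrite -W1 in Rc1; rewrite -W2 in Rc2.
rewrite (mem_orbit_basis Sr rc) (mem_orbit_basis Ss sc) q'E.
by apply/andP; split; apply/mem_orbit_rel; exists W.
Qed.

Lemma orbit_fiberP D :
  fiber orbit_basis D <-> exists i, D = orbit_fiber i.
Proof.
split=> [/imsetP[[u v] _ eqD]|[i ->]].
  have := orbit_rel_refl (u, v); rewrite -eqD mem_diag => /andP[_ /eqP eq_uv].
  exists (tag u); apply/setP=> w.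
  have /setP/(_ (w, w)) : diag D = diag (orbit_fiber (tag u)).
    by rewrite diag_orbit_fiber eqD -eq_uv.
  by rewrite !mem_diag eqxx !andbT.
by rewrite /fiber (diag_orbit_fiber (Tagged gT (1 : gT i))) orbit_basisT.
Qed.

Lemma orbit_fiber_inj : injective orbit_fiber.
Proof.
move=> i j /setP/(_ (Tagged gT (1 : gT i))).
by rewrite !inE /= eqxx => /esym/eqP.
Qed.

(** Right multiplication by x: its graph is an orbit of the left translations of [gT i]. *)
Definition orbit_grp_rel i (x : gT i) : {set pt * pt} :=
  orbit_rel (Tagged gT (1 : gT i), Tagged gT x).

Lemma mem_orbit_grp_rel i (x y z : gT i) :
  ((Tagged gT x, Tagged gT y) \in orbit_grp_rel z) = (y == x * z).
Proof.
rewrite orbit_rel_Tagged (linkage_id LR) invg1 mulg1.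
by rewrite eq_sym -(inj_eq (mulIg z)) mulgKV.
Qed.

Lemma orbit_grp_relP i (z : gT i) u v :
  (u, v) \in orbit_grp_rel z ->
  exists x : gT i, u = Tagged gT x /\ v = Tagged gT (x * z).
Proof.
case/mem_orbit_rel=> W /= _ [-> ->]; exists (W i * 1).
by rewrite /shift /= !mulg1.
Qed.

Lemma orbit_grp_rel_inj i : injective (@orbit_grp_rel i).
Proof.
move=> x y /setP/(_ (Tagged gT (1 : gT i), Tagged gT x)).
by rewrite !mem_orbit_grp_rel !mul1g eqxx => /esym/eqP.
Qed.

Lemma orbit_grp_rel_im i :
  [set orbit_grp_rel x | x in [set: gT i]] = inside orbit_basis (orbit_fiber i).
Proof.
apply/setP=> s; rewrite inE; apply/imsetP/andP => [[x _ ->]|[]].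
  split; first exact: orbit_basisT.
  by apply/subsetP=> [[u v]] /orbit_grp_relP[y [-> ->]]; rewrite !inE /= !eqxx.
case/imsetP=> [[u v] _ ->] /subsetP/(_ _ (orbit_rel_refl _)).
case: u v => [k x] [l y]; rewrite !inE /= => /andP[/eqP eq_k /eqP eq_l].
rewrite {}eq_k {}eq_l in x y *; exists (x^-1 * y) => //.
by apply: orbit_rel_eq; rewrite mem_orbit_grp_rel mulKVg.
Qed.

Lemma orbit_grp_relM i (x y : gT i) :
  orbit_grp_rel (x * y) = compose (orbit_grp_rel x) (orbit_grp_rel y).
Proof.
apply/setP=> [[u v]]; apply/idP/mem_compose.
  case/orbit_grp_relP=> z [-> ->]; exists (Tagged gT (z * x)).
    by rewrite mem_orbit_grp_rel.
  by rewrite mem_orbit_grp_rel mulgA.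
case=> w /orbit_grp_relP[z [-> ->]] /orbit_grp_relP[z' [/eqP]].
by rewrite eq_Tagged /= => /eqP <- ->; rewrite mem_orbit_grp_rel mulgA.
Qed.

Lemma orbit_quasiregular : quasiregular orbit_basis.
Proof.
move=> D /orbit_fiberP[i ->] s; rewrite -orbit_grp_rel_im => /imsetP[x _ ->] u.
split; apply/card_le1_eqP => v w;
  rewrite ![_ \in neighbours _ _]inE ?mem_converse.
  case/orbit_grp_relP=> y [-> ->] /orbit_grp_relP[z [/eqP]].
  by rewrite eq_Tagged /= => /eqP -> ->.
case/orbit_grp_relP=> y [-> ->] /orbit_grp_relP[z [-> /eqP]].
by rewrite eq_Tagged /= => /eqP/mulIg ->.
Qed.

Definition orbit_config : qr_config gT :=
  QrConfig orbit_basis_coherent orbit_quasiregular orbit_fiber_inj orbit_fiberP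
    orbit_grp_rel_inj orbit_grp_rel_im orbit_grp_relM.

Definition orbit_base_point i : orbit_config := Tagged gT (1 : gT i).

Lemma orbit_base_points : base_points orbit_base_point.
Proof. by move=> i; rewrite inE. Qed.

Lemma config_rel_orbit i j x y : config_rel orbit_base_point x y = R i j x y.
Proof.
have ptE k (z : gT k) : point orbit_base_point z = Tagged gT z.
  have := base_point_rel orbit_base_points z.
  by case/orbit_grp_relP=> z' [/eqP]; rewrite eq_Tagged /= => /eqP <-; rewrite mul1g.
rewrite /config_rel !ptE.
have [Sp /(mem_orbit_basis Sp) pE] :=
  basis_pblock orbit_basis_coherent (orbit_base_point i, orbit_base_point j).
by rewrite /base_rel [pblock _ _]pE orbit_rel_Tagged !invg1 !mulg1.
Qed.

End Construction.

Theorem theorem4p7 (I : finType) (gT : I -> finGroupType) :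
  [/\ forall (X : qr_config gT) (a : I -> X),
        base_points a -> linked (system_of a),
      forall (X Y : qr_config gT) (a : I -> X) (b : I -> Y),
        base_points a -> base_points b ->
        (same_system (system_of a) (system_of b) <-> based_iso a b)
    & forall F : quotient_data gT, linked F ->
        exists (X : qr_config gT) (a : I -> X),
          base_points a /\ same_system (system_of a) F].
Proof.
split=> [X a base_a|X Y a b base_a base_b|F LF].
- apply: linked_of_linkage (config_rel_linkage base_a) _.
  exact: config_rel_represents.
- have Ra := config_rel_represents base_a.
  have Rb := config_rel_represents base_b.
  (* Both sides amount to the equality of the two linkages. *)
  split=> [/(same_represents Ra Rb)/(config_rel_iso base_a base_b) //|].
  move/(config_rel_iso base_a base_b) => eqR.
  exact: represents_same eqR Ra Rb.
have LR := linkage_of_linked LF.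
exists (orbit_config LR), (orbit_base_point LR).
have base_a := orbit_base_points LR; split=> //.
apply: represents_same (config_rel_represents base_a) (system_rel_represents LF).
exact: config_rel_orbit.
Qed.
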